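(* Let $m\in\mathbb{N}$, $\eta>0$, $\gamma>0$, $0\le\alpha\le 1$, $s\in\mathbb{N}\cup\{0\}$, $z\in[0,1]$, $M>0$ and $0<\kappa\le 1$. Let $\phi\in C[0,1]$ with $\phi\in Lip_M(\kappa)$, i.e. $|\phi(w)-\phi(q)|\le M|w-q|^{\kappa}$ for all $w,q\in[0,1]$. Then $$\left|\Re_{m,\eta,\gamma}^{(\alpha,s)}(\phi;z)-\phi(z)\right|\le M\left(\varphi_{m,\eta,\gamma}^{(\alpha,s)}(z)\right)^{\kappa/2},$$ where $\varphi_{m,\eta,\gamma}^{(\alpha,s)}(z)=\Re_{m,\eta,\gamma}^{(\alpha,s)}((t-z)^2;z)$ is the second central moment.
   Context: $\mathbb{N}$ denotes the positive integers, and $C[0,1]$ the real-valued continuous functions on $[0,1]$. Binomial coefficients are $\binom{a}{b}=\frac{a!}{b!(a-b)!}$ if $0\le b\le a$ and $0$ otherwise; a term whose binomial coefficient is $0$ is understood to be $0$, and $0^0=1$. For $m\in\mathbb{N}$, $0\le j\le m$, $0\le\alpha\le1$, $s\in\mathbb{N}\cup\{0\}$ and $z\in[0,1]$ put: if $m<s$, $$q_{m,j}^{(\alpha,s)}(z)=\binom{m}{j}z^j(1-z)^{m-j};$$ if $m\ge s$, $$q_{m,j}^{(\alpha,s)}(z)=(1-\alpha)\binom{m-s}{j-s}z^{j-s+1}(1-z)^{m-j}+(1-\alpha)\binom{m-s}{j}z^{j}(1-z)^{m-s-j+1}+\alpha\binom{m}{j}z^j(1-z)^{m-j}.$$ For $\eta>0$,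 $\gamma>0$ and $\phi\in C[0,1]$ define, with $\Gamma$ the Gamma function, $$\Re_{m,\eta,\gamma}^{(\alpha,s)}(\phi;z)=\Gamma(\eta+1)\sum_{j=0}^{m}q_{m,j}^{(\alpha,s)}(z)\int_0^1\frac{(1-t)^{\eta-1}}{\Gamma(\eta)}\,\phi\!\left(\frac{j+t^{\gamma}}{m+1}\right)dt .$$ The notation $\Re_{m,\eta,\gamma}^{(\alpha,s)}((t-z)^2;z)$ means the operator applied to the function $t\mapsto(t-z)^2$ with $z$ fixed, evaluated at $z$. *)

(* Defs.v *)
From mathcomp Require Import all_boot all_order all_algebra.
From mathcomp Require Import all_classical all_reals all_analysis.
Import Order.TTheory GRing.Theory Num.Theory.
Import numFieldNormedType.Exports.

Set Implicit Arguments.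
Unset Strict Implicit.
Unset Printing Implicit Defensive.

Local Open Scope classical_set_scope.
Local Open Scope ring_scope.

(* Euler's integral, meaningful for 0 < x. For x < 1 the integrand is singular
   at 0, where [powR] gives it the value 0; a single point has measure zero. *)
Definition Gamma (R : realType) (x : R) : R :=
  \int[lebesgue_measure]_(t in `[0, +oo[) (t `^ (x - 1) * expR (- t)).

(* Basis function q_{m,j}^(alpha,s)(z), for j <= m. Natural subtraction
   truncates, so 'C(m - s, j - s) would be 1 for j < s; the test [s <= j]
   restores the convention that this binomial coefficient is then 0. In every
   other term the subtractions truncate only where the coefficient is 0. *)
Definition basis_fun (R : realType) (alpha : R) (s m j : nat) (z : R) : R :=
  if (m < s)%N then 'C(m, j)%:R * z ^+ j * (1 - z) ^+ (m - j)
  else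
    (1 - alpha) *
      (if (s <= j)%N
       then 'C(m - s, j - s)%:R * z ^+ (j - s + 1) * (1 - z) ^+ (m - j)
       else 0)
    + (1 - alpha) * 'C(m - s, j)%:R * z ^+ j * (1 - z) ^+ (m - s - j + 1)
    + alpha * 'C(m, j)%:R * z ^+ j * (1 - z) ^+ (m - j).

(* For j <= m and t in [0, 1], phi is evaluated only at points of [0, 1]. For
   eta < 1 the singularity at t = 1 is handled as in [Gamma]. *)
Definition frac_op (R : realType) (alpha : R) (s m : nat) (eta gamma : R)
    (phi : R -> R) (z : R) : R :=
  Gamma (eta + 1) *
  \sum_(j < m.+1)
    basis_fun alpha s m j z *
    \int[lebesgue_measure]_(t in `[0, 1])
      ((1 - t) `^ (eta - 1) / Gamma eta *
       phi ((j%:R + t `^ gamma) / (m.+1)%:R)).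

Definition second_central_moment (R : realType) (alpha : R) (s m : nat)
    (eta gamma : R) (z : R) : R :=
  frac_op alpha s m eta gamma (fun t => (t - z) ^+ 2) z.

Definition Lip (R : realType) (M kappa : R) : set (R -> R) :=
  [set phi : R -> R | forall w q : R, w \in `[0, 1] -> q \in `[0, 1] ->
     `|phi w - phi q| <= M * `|w - q| `^ kappa].

(* Main.v *)
Require Import Defs.
From mathcomp Require Import all_boot all_order all_algebra.
From mathcomp Require Import all_classical all_reals all_analysis.
From mathcomp Require Import measurable_realfun ring lra.
Import Order.TTheory GRing.Theory Num.Theory.
Import numFieldNormedType.Exports.

(* Since Gamma (eta + 1) = eta * Gamma eta and the basis functions sum to 1, the
   operator is an average over [0, 1]. By the Lipschitz condition, the error is
   at most M times the average of ((x - z)^2)^p with p = kappa / 2. Instead of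
   Jensen's inequality, the concave power is bounded by its tangent at c > 0, so
   that only monotonicity and linearity of the average are needed; c is then
   taken to be the second central moment. *)

Set Implicit Arguments.
Unset Strict Implicit.
Unset Printing Implicit Defensive.

Local Open Scope classical_set_scope.
Local Open Scope ring_scope.

(** * Fundamental theorem of calculus on segments and the total mass of the fractional weight *)

Lemma integral_derive_segment (R : realType) (F f : R -> R) (a b : R) :
  a < b ->
  (forall x, a <= x <= b -> is_derive x 1 F (f x)) ->
  (forall x, a <= x <= b -> {for x, continuous f}) ->
  (\int[lebesgue_measure]_(x in `[a, b]) (f x)%:E = (F b - F a)%:E)%E.
Proof.
move=> ab dF cf; rewrite EFinB; apply: continuous_FTC2 => //.
- by apply: continuous_in_subspaceT => x; rewrite inE/= in_itv/=; exact: cf.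
- have cF x : a <= x <= b -> {for x, continuous F}.
    by move=> /dF dFx; apply/differentiable_continuous/derivable1_diffP.
  split.
  + move=> x; rewrite in_itv/= => /andP[ax xb].
    by have [] : is_derive x 1 F (f x) by apply: dF; rewrite !ltW.
  + by apply/cvg_at_right_filter/cF; rewrite lexx ltW.
  + by apply/cvg_at_left_filter/cF; rewrite lexx ltW.
- move=> x; rewrite in_itv/= => /andP[ax xb]; rewrite derive1E.
  by have [] : is_derive x 1 F (f x) by apply: dF; rewrite !ltW.
Qed.

Lemma continuous_powR (R : realType) (r x : R) :
  0 < x -> {for x, continuous (fun t => t `^ r)}.
Proof.
move=> x0; apply/differentiable_continuous/derivable1_diffP.
by apply: derivable_powR; rewrite in_itv/= x0.
Qed.

Lemma measurable_onem_powR (R : realType) (r : R) :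
  measurable_fun [set: R] (fun t : R => (1 - t) `^ r).
Proof.
apply: (measurableT_comp (measurable_powR r)).
by apply: measurable_funB => //; exact: measurable_cst.
Qed.

(** Exhaustion of the half-open interval by segments that avoid the singularity at 1. The index
    [n.+2] makes even the first segment nondegenerate, as the fundamental theorem requires. *)
Lemma bigcup_itv_onem_invS (R : realType) :
  \bigcup_n [set` `[0 : R, 1 - n.+2%:R^-1]] = [set` `[0 : R, 1[].
Proof.
apply/seteqP; split => x /=.
  move=> [n _] /=; rewrite !in_itv/= => /andP[-> /le_lt_trans]; apply.
  by rewrite ltrBlDr ltrDl invr_gt0.
rewrite in_itv/= => /andP[x0 x1].
have x1' : 0 < 1 - x by rewrite subr_gt0.
have [n nP] : exists n, (1 - x)^-1 < n.+2%:R :> R.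
  exists (Num.truncn (1 - x)^-1); apply: (lt_trans (truncnS_gt _)).
  by rewrite ltr_nat.
exists n => //=; rewrite in_itv/= x0/= lerBrDl -lerBrDr.
by rewrite invf_ple ?posrE// ltW.
Qed.

Lemma cvg_invS_powR (R : realType) (r : R) : 0 < r ->
  (n.+2%:R^-1 : R) `^ r @[n --> \oo] --> 0.
Proof.
move=> r0; have /cvg_at_rightP := powR_cvg0 r0; apply; split => //.
by have := @cvg_harmonic R; rewrite -cvg_shiftS.
Qed.

(** For eta < 1 the integrand is unbounded near 1. The null endpoint 1 is dropped, the
    antiderivative -(1 - t)^eta / eta is used on the segments [0, 1 - 1/(n+2)], and monotone
    convergence gives the limit. *)
Lemma integral_onem_powR (R : realType) (eta : R) : 0 < eta ->
  (\int[lebesgue_measure]_(t in `[0%R, 1%R]) ((1 - t) `^ (eta - 1))%:E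
    = (eta^-1)%:E)%E.
Proof.
move=> eta0; set w := fun t : R => (1 - t) `^ (eta - 1).
have mw (D : set R) : measurable_fun D (EFin \o w).
  apply/measurable_EFinP/measurable_funTS; exact: measurable_onem_powR.
rewrite -[LHS]/(\int[lebesgue_measure]_(t in `[0%R, 1%R]) ((EFin \o w) t))%E.
rewrite -integral_itv_bndo_bndc// -bigcup_itv_onem_invS.
pose F (n : nat) := [set` `[0 : R, 1 - n.+2%:R^-1]].
have ndF : nondecreasing_seq F.
  move=> m n mn; apply/subsetPset => x; rewrite /F/= !in_itv/= => /andP[->/=].
  by move=> /le_trans; apply; rewrite lerB// lef_pV2 ?posrE// ler_nat !ltnS.
have w0 (i : nat) x : F i x -> (0 <= (EFin \o w) x)%E.
  by rewrite lee_fin powR_ge0.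
have /cvg_lim <- // := ge0_nondecreasing_set_cvg_integral (mu := lebesgue_measure) ndF
  (fun i => measurable_itv _) (fun i => mw (F i)) w0.
apply/cvg_lim => //.
have -> : (fun i : nat => \int[lebesgue_measure]_(x in F i) (EFin \o w) x)%E =
   (fun i : nat => (eta^-1 - eta^-1 * (i.+2%:R^-1) `^ eta)%:E).
  apply/funext => n.
  have n2 : n.+2%:R^-1 < 1 :> R by rewrite invf_lt1// ltr1n.
  transitivity ((- eta^-1 * (1 - (1 - n.+2%:R^-1)) `^ eta
      - (- eta^-1 * (1 - 0) `^ eta))%:E); last first.
    by congr EFin; rewrite subr0 powR1 subKr; ring.
  apply: (@integral_derive_segment _ (fun t => - eta^-1 * (1 - t) `^ eta) w).
  - by rewrite subr_gt0.
  - move=> x /andP[x0 xn].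
    have x1 : 0 < 1 - x.
      by rewrite subr_gt0 (le_lt_trans xn)// ltrBlDr ltrDl invr_gt0.
    have d1 : is_derive x 1 (fun t : R => 1 - t) (-1).
      by apply: is_derive_eq; rewrite add0r mul1r.
    have dp := is_derive1_powR eta x1.
    have dc : is_derive x 1 (fun t : R => (1 - t) `^ eta)
        (eta * (1 - x) `^ (eta - 1) * -1).
      exact: (@is_derive1_comp _ (fun y : R => y `^ eta) _ x _ _ dp d1).
    apply: (is_derive_eq (is_deriveZ (- eta^-1) dc)).
    by rewrite /w /GRing.scale/= mulrN1 mulrNN mulKf// gt_eqF.
  - move=> x /andP[x0 xn].
    have x1 : 0 < 1 - x.
      by rewrite subr_gt0 (le_lt_trans xn)// ltrBlDr ltrDl invr_gt0.
    apply: (@continuous_comp _ _ _ (fun t : R => 1 - t) (fun y => y `^ (eta - 1))).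
      by apply: cvgB; [exact: cvg_cst|exact: cvg_id].
    exact: continuous_powR.
apply: cvg_EFin; first exact: nearW.
rewrite -[X in _ --> X]subr0 -[X in _ --> _ - X](mulr0 eta^-1).
apply: cvgB; first exact: cvg_cst.
by apply: cvgMr; exact: cvg_invS_powR.
Qed.

(** * The Gamma function: functional equation, finiteness and positivity *)

(** Apply ln u < u to u = t / (2r), multiply by r and exponentiate. Half of the decay of e^(-t) thus
    absorbs the power, which serves both for integrability and for the boundary term at infinity. *)
Lemma powR_le_expR_half (R : realType) (r t : R) : 0 < r -> 0 < t ->
  t `^ r <= (2 * r) `^ r * expR (t / 2).
Proof.
move=> r0 t0; rewrite /powR !gt_eqF ?mulr_gt0//= -expRD ler_expR.
have r20 : 0 < 2 * r by rewrite mulr_gt0.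
have /ltW := ln_sublinear (divr_gt0 t0 r20).
rewrite ln_div ?posrE ?mulr_gt0// => h.
have {h} : r * (ln t - ln (2 * r)) <= r * (t / (2 * r)) by rewrite ler_pM2l.
rewrite mulrBr lerBlDl => /le_trans; apply; rewrite lerD2l.
by rewrite (_ : r * (t / (2 * r)) = t / 2)//; field; rewrite gt_eqF.
Qed.

Lemma continuous_Gamma_integrand (R : realType) (r x : R) : 0 < x ->
  {for x, continuous (fun t => t `^ r * expR (- t))}.
Proof.
move=> x0; apply: continuousM; first exact: continuous_powR.
apply: (@continuous_comp _ _ _ -%R (@expR R)); first exact: opp_continuous.
exact: continuous_expR.
Qed.

Lemma integrable_Gamma_segment (R : realType) (r a b : R) : 0 < a ->
  lebesgue_measure.-integrable `[a, b]
    (fun t : R => (t `^ r * expR (- t))%:E).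
Proof.
move=> a0; apply: continuous_compact_integrable; first exact: segment_compact.
apply: continuous_in_subspaceT => x; rewrite inE/= in_itv/= => /andP[ax _].
exact/continuous_Gamma_integrand/(lt_le_trans a0).
Qed.

(** The function -t^r e^(-t) has derivative t^r e^(-t) - r t^(r-1) e^(-t). Since 0 < a, everything
    is continuous on the segment, whatever the sign of r. *)
Lemma Gamma_by_parts_segment (R : realType) (r a b : R) : 0 < a -> a < b ->
  (\int[lebesgue_measure]_(t in `[a, b]) (t `^ r * expR (- t))%:E =
   (a `^ r * expR (- a) - b `^ r * expR (- b))%:E +
   r%:E * \int[lebesgue_measure]_(t in `[a, b])
     (t `^ (r - 1) * expR (- t))%:E)%E.
Proof.
move=> a0 ab.
have int1 := @integrable_Gamma_segment R r a b a0.
have int0 := @integrable_Gamma_segment R (r - 1) a b a0.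
have intr : lebesgue_measure.-integrable `[a, b]
    (EFin \o (fun t : R => r * (t `^ (r - 1) * expR (- t)))).
  exact: (integrableZl _ r int0).
have <- : (\int[lebesgue_measure]_(t in `[a, b])
    (t `^ r * expR (- t) - r * (t `^ (r - 1) * expR (- t)))%:E =
   (a `^ r * expR (- a) - b `^ r * expR (- b))%:E)%E.
  pose F (t : R) := - (t `^ r * expR (- t)).
  transitivity (F b - F a)%:E; last by rewrite /F; congr EFin; ring.
  apply: integral_derive_segment => //.
  - move=> x /andP[ax _]; have x0 := lt_le_trans a0 ax.
    have dp := is_derive1_powR r x0.
    have dN : is_derive x 1 (fun t : R => - t) (-1).
      by apply: is_derive_eq.
    have de : is_derive x 1 (fun t : R => expR (- t)) (expR (- x) * -1).
      exact: (@is_derive1_comp _ (@expR R) -%R x _ _ (is_derive_expR (- x)) dN).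
    apply: (is_derive_eq (is_deriveN (is_deriveM dp de))).
    rewrite /GRing.scale/=; ring.
  - move=> x /andP[ax _]; have x0 := lt_le_trans a0 ax.
    apply: continuousB; first exact: continuous_Gamma_integrand.
    apply: continuousM; first exact: cvg_cst.
    exact: continuous_Gamma_integrand.
rewrite -integralZl//.
rewrite -integralD//; last exact: (integrableB _ int1 intr).
by apply: eq_integral => t _; rewrite -EFinM -EFinD subrK.
Qed.

Lemma bigcup_itv_invS (R : realType) :
  \bigcup_n [set` `[n.+2%:R^-1 : R, n.+2%:R]] = [set` `]0 : R, +oo[].
Proof.
apply/seteqP; split => x /=.
  move=> [n _] /=; rewrite !in_itv/= andbT => /andP[+ _].
  by apply: lt_le_trans; rewrite invr_gt0.
rewrite in_itv/= andbT => x0.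
have xV0 : 0 < x^-1 by rewrite invr_gt0.
(* An index controlled by x + 1/x exceeds x and 1/x at once, so x lies between both endpoints. *)
exists (Num.truncn (x + x^-1)) => //=; rewrite in_itv/=.
have : x + x^-1 < (Num.truncn (x + x^-1)).+2%:R.
  by apply: (lt_trans (truncnS_gt _)); rewrite ltr_nat.
set N := _%:R => xN.
have N0 : 0 < N by rewrite ltr0n.
apply/andP; split; last by lra.
by rewrite invf_ple ?posrE//; lra.
Qed.

(** Monotone convergence along the increasing segments, in the extended reals: the limit may be
    infinite at this stage. *)
Lemma cvg_Gamma_segment (R : realType) (r : R) :
  (\int[lebesgue_measure]_(t in `[(n.+2%:R^-1 : R)%R, n.+2%:R%R])
      (t `^ r * expR (- t))%:E @[n --> \oo] -->
   \int[lebesgue_measure]_(t in `]0%R, +oo[) (t `^ r * expR (- t))%:E)%E.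
Proof.
pose F (n : nat) := [set` `[n.+2%:R^-1 : R, n.+2%:R]].
rewrite -bigcup_itv_invS.
have ndF : nondecreasing_seq F.
  move=> m n mn; apply/subsetPset => x; rewrite /F/= !in_itv/= => /andP[mx xm].
  apply/andP; split.
    by apply: le_trans mx; rewrite lef_pV2 ?posrE// ler_nat !ltnS.
  by apply: (le_trans xm); rewrite ler_nat !ltnS.
have mf (i : nat) :
    measurable_fun (F i) (fun t : R => (t `^ r * expR (- t))%:E).
  apply/measurable_EFinP/measurable_funTS.
  apply: measurable_funM; first exact: measurable_powR.
  exact: measurableT_comp.
have f0 (i : nat) (x : R) : F i x -> (0 <= (x `^ r * expR (- x))%:E)%E.
  by rewrite lee_fin mulr_ge0 ?powR_ge0 ?expR_ge0.
exact: (ge0_nondecreasing_set_cvg_integral (mu := lebesgue_measure) ndF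
  (fun i => measurable_itv _) mf f0).
Qed.

(** With N = n + 2, the term at 1/N is at most N^(-r). The term at N is at most (2r)^r e^(-N/2),
    hence at most (2r)^r 2/N by e^x >= 1 + x. *)
Lemma cvg_Gamma_boundary (R : realType) (r : R) : 0 < r ->
  (n.+2%:R^-1 : R) `^ r * expR (- n.+2%:R^-1) -
    (n.+2%:R : R) `^ r * expR (- n.+2%:R) @[n --> \oo] --> 0.
Proof.
move=> r0; rewrite -[X in _ --> X]subr0; apply: cvgB.
- apply: (squeeze_cvgr _ (cvg_cst 0) (cvg_invS_powR r0)).
  apply: nearW => n; rewrite mulr_ge0 ?powR_ge0 ?expR_ge0//=.
  by rewrite ler_piMr ?powR_ge0// -expR0 ler_expR oppr_le0 invr_ge0.
- apply: (@squeeze_cvgr _ _ _ _ (cst 0) (fun n : nat =>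
    (2 * r) `^ r * 2 * (n.+2%:R^-1) `^ 1)).
  + apply: nearW => n; rewrite mulr_ge0 ?powR_ge0 ?expR_ge0//=.
    apply: (le_trans (ler_wpM2r (expR_ge0 _) (powR_le_expR_half r0 _))) => //.
    rewrite -!mulrA -expRD ler_wpM2l ?powR_ge0// powRr1 ?invr_ge0//.
    rewrite (_ : n.+2%:R / 2 - n.+2%:R = - (n.+2%:R / 2)); last by field.
    rewrite expRN -[leRHS]invrK lef_pV2 ?posrE ?expR_gt0 ?invr_gt0 ?mulr_gt0//.
    rewrite invfM invrK mulrC; apply: le_trans (expR_ge1Dx _).
    by rewrite lerDr.
  + exact: cvg_cst.
  + rewrite -[X in _ --> X](mulr0 ((2 * r) `^ r * 2)); apply: cvgMr.
    exact: cvg_invS_powR.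
Qed.

(** Limit of the integration by parts on segments. As the boundary terms tend to the finite value 0,
    the sum of limits is defined even if the integrals are infinite; finiteness is deduced from this
    identity afterwards. *)
Lemma Gamma_integral_recurrence (R : realType) (r : R) : 0 < r ->
  (\int[lebesgue_measure]_(t in `]0%R, +oo[) (t `^ r * expR (- t))%:E =
   r%:E * \int[lebesgue_measure]_(t in `]0%R, +oo[)
     (t `^ (r - 1) * expR (- t))%:E)%E.
Proof.
move=> r0; have /cvg_lim <- // := @cvg_Gamma_segment R r.
apply/cvg_lim => //; rewrite -[X in _ --> X]add0e.
have -> : (fun n : nat => \int[lebesgue_measure]_(t in `[(n.+2%:R^-1 : R)%R, n.+2%:R%R])
      (t `^ r * expR (- t))%:E)%E =
   (fun n : nat => ((n.+2%:R^-1 : R) `^ r * expR (- n.+2%:R^-1) -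
    (n.+2%:R : R) `^ r * expR (- n.+2%:R))%:E + r%:E *
   \int[lebesgue_measure]_(t in `[(n.+2%:R^-1 : R)%R, n.+2%:R%R])
      (t `^ (r - 1) * expR (- t))%:E)%E.
  apply/funext => n; apply: Gamma_by_parts_segment; first by rewrite invr_gt0.
  by rewrite (@lt_trans _ _ 1)// ?invf_lt1 ?ltr1n.
apply: cvgeD.
- by [].
- apply: cvg_EFin; first exact: nearW.
  exact: cvg_Gamma_boundary.
- by apply: cvgeZl => //; exact: cvg_Gamma_segment.
Qed.

(** The singularity at 0 is never estimated directly. By the recurrence, r times this integral is
    the integral of t^r e^(-t), which is dominated by a multiple of e^(-t/2); so the value +oo is
    impossible. *)
Lemma Gamma_integral_fin_num (R : realType) (r : R) : 0 < r ->
  (\int[lebesgue_measure]_(t in `]0%R, +oo[)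
     (t `^ (r - 1) * expR (- t))%:E \is a fin_num)%E.
Proof.
move=> r0.
set I := (\int[_]_(_ in _) _)%E.
have I0 : (0 <= I)%E.
  by apply: integral_ge0 => t _; rewrite lee_fin mulr_ge0 ?powR_ge0 ?expR_ge0.
have := Gamma_integral_recurrence r0; rewrite -/I.
have : lebesgue_measure.-integrable `]0%R, +oo[
    (fun t : R => (t `^ r * expR (- t))%:E).
  have := @integrable_exponential_pdf R (1 / 2).
  rewrite divr_gt0// => /(_ isT) ie.
  have {}ie : lebesgue_measure.-integrable `]0%R, +oo[
      (EFin \o exponential_pdf (1 / 2 : R)).
    by apply: integrableS ie.
  (* The exponential density of rate 1/2 is e^(-t/2) / 2, whence the extra factor 2 in front of
     (2r)^r. *)
  apply: le_integrable (integrableZl _ (2 * (2 * r) `^ r) ie) => //.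
    apply/measurable_EFinP/measurable_funTS.
    apply: measurable_funM; first exact: measurable_powR.
    exact: measurableT_comp.
  move=> t /=; rewrite in_itv/= andbT => t0.
  rewrite lee_fin exponential_pdfE; last exact: ltW.
  rewrite !ger0_norm; last 2 first.
  - by rewrite !mulr_ge0 ?powR_ge0 ?expR_ge0// ltW.
  - by rewrite !mulr_ge0 ?powR_ge0 ?expR_ge0// ltW.
  apply: (le_trans (ler_wpM2r (expR_ge0 _) (powR_le_expR_half r0 t0))).
  rewrite -mulrA -expRD (_ : t / 2 - t = - (1 / 2) * t); last by field.
  by rewrite mulrA (_ : 2 * (2 * r) `^ r * (1 / 2) = (2 * r) `^ r)//; field.
move=> /integrable_fin_num => /(_ (measurable_itv _)) => /[swap] ->.
move: I0; case: I => [x| |]//= _.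
by rewrite mulry gtr0_sg// mul1e.
Qed.

Lemma GammaE (R : realType) (r : R) :
  Gamma r = fine (\int[lebesgue_measure]_(t in `]0%R, +oo[)
     (t `^ (r - 1) * expR (- t))%:E)%E.
Proof.
rewrite /Gamma /Rintegral integral_itv_obnd_cbnd//.
apply/measurable_EFinP/measurable_funTS.
apply: measurable_funM; first exact: measurable_powR.
exact: measurableT_comp.
Qed.

Lemma GammaD1 (R : realType) (r : R) : 0 < r -> Gamma (r + 1) = r * Gamma r.
Proof.
move=> r0; rewrite !GammaE addrK Gamma_integral_recurrence// fineM//.
exact: Gamma_integral_fin_num.
Qed.

(** The integrand is nonnegative and at least a positive constant on [1, 2]. *)
Lemma Gamma_gt0 (R : realType) (r : R) : 0 < r -> 0 < Gamma r.
Proof.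
move=> r0; rewrite GammaE; apply: fine_gt0; apply/andP; split; last first.
  by rewrite ltey_eq Gamma_integral_fin_num.
(* On [1, 2] one has 0 <= ln t <= 2, so (r - 1) ln t >= -2 |r - 1|, while -t >= -2. *)
pose c := expR (- (`|r - 1| * 2) - 2).
apply: (@lt_le_trans _ _ (\int[lebesgue_measure]_(t in `[1%R, 2%R]) c%:E)%E).
  rewrite integral_cst//= lebesgue_measure_itv/= lte_fin ltr1n/= -EFinB -EFinM.
  by rewrite lte_fin mulr_gt0 ?expR_gt0//; lra.
have mG (D : set R) :
    measurable_fun D (fun t : R => (t `^ (r - 1) * expR (- t))%:E).
  apply/measurable_EFinP/measurable_funTS.
  apply: measurable_funM; first exact: measurable_powR.
  exact: measurableT_comp.
apply: (@le_trans _ _ (\int[lebesgue_measure]_(t in `[1%R, 2%R])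
    (t `^ (r - 1) * expR (- t))%:E)%E).
  apply: ge0_le_integral => //.
  - by move=> t _; rewrite lee_fin expR_ge0.
  - exact: mG.
  - move=> t /=; rewrite in_itv/= => /andP[t1 t2]; rewrite lee_fin.
    have t0 : 0 < t by rewrite (lt_le_trans ltr01).
    rewrite /powR gt_eqF// -expRD ler_expR lerB//.
    have lnt0 : 0 <= ln t by exact: ln_ge0.
    have lnt2 : ln t <= 2 by rewrite (le_trans (ltW (ln_sublinear t0))).
    rewrite lerNl; apply: le_trans (ler_norm _) _.
    by rewrite normrN normrM (ger0_norm lnt0) ler_wpM2l.
apply: ge0_subset_integral => //.
- exact: mG.
- by move=> t _; rewrite lee_fin mulr_ge0 ?powR_ge0 ?expR_ge0.
- by move=> t /=; rewrite !in_itv/= andbT => /andP[+ _]; apply: lt_le_trans.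
Qed.

(** * The basis functions form a nonnegative partition of unity *)

Lemma sum_bernstein (R : comPzRingType) (n : nat) (z : R) :
  \sum_(j < n.+1) 'C(n, j)%:R * z ^+ j * (1 - z) ^+ (n - j) = 1.
Proof.
rewrite -[RHS](expr1n _ n) -[in RHS](subrK z 1) exprDn.
by apply: eq_bigr => j _; rewrite -mulrA mulr_natl mulrC.
Qed.

(** For s <= m the three groups of terms reduce to Bernstein sums of degrees m - s, m - s and m,
    with total (1 - alpha) z + (1 - alpha) (1 - z) + alpha = 1. *)
Lemma sum_basis_fun (R : realType) (alpha z : R) (s m : nat) :
  \sum_(j < m.+1) basis_fun alpha s m j z = 1.
Proof.
rewrite /basis_fun; case: (ltnP m s) => [_|sm]; first exact: sum_bernstein.
rewrite 2!big_split/= -mulr_sumr.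
have -> : \sum_(j < m.+1) (if (s <= j)%N then
    'C(m - s, j - s)%:R * z ^+ (j - s + 1) * (1 - z) ^+ (m - j) else 0) = z.
  pose F j := if (s <= j)%N then
    'C(m - s, j - s)%:R * z ^+ (j - s + 1) * (1 - z) ^+ (m - j) else 0.
  (* The terms with j < s vanish; shifting the index by s leaves z times a Bernstein sum. *)
  rewrite -(big_mkord xpredT F) (@big_cat_nat _ _ _ s)//=; last exact: leqW.
  rewrite big_nat big1 ?add0r; last first.
    by move=> j /andP[_ js]; rewrite /F leqNgt js.
  rewrite -{1}[s]add0n big_addn subSn// big_mkord.
  rewrite -[RHS]mulr1 -(sum_bernstein (m - s) z) mulr_sumr.
  apply: eq_bigr => j _; rewrite /F leq_addl addnK addn1 exprS/=.
  by rewrite -subnDA [(s + j)%N]addnC mulrCA !mulrA.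
under [X in _ + X + _]eq_bigr do rewrite -2!mulrA.
rewrite -mulr_sumr.
have -> : \sum_(j < m.+1) ('C(m - s, j)%:R * (z ^+ j *
    (1 - z) ^+ (m - s - j + 1))) = 1 - z.
  pose F j := 'C(m - s, j)%:R * (z ^+ j * (1 - z) ^+ (m - s - j + 1)).
  (* The terms with j > m - s have a zero binomial coefficient; the rest is 1 - z times a Bernstein
     sum. *)
  rewrite -(big_mkord xpredT F) (@big_cat_nat _ _ _ (m - s).+1)//=; last first.
    by rewrite ltnS leq_subr.
  rewrite [X in _ + X]big_nat [X in _ + X]big1 ?addr0; last first.
    by move=> j /andP[js _]; rewrite /F bin_small// mul0r.
  rewrite big_mkord -[RHS]mulr1 -[X in _ = _ * X](sum_bernstein (m - s) z) mulr_sumr.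
  by apply: eq_bigr => j _; rewrite /F addn1 exprS mulrA mulrCA.
under eq_bigr do rewrite -2!mulrA.
rewrite -mulr_sumr; under eq_bigr do rewrite mulrA.
by rewrite sum_bernstein; ring.
Qed.

Lemma basis_fun_ge0 (R : realType) (alpha z : R) (s m j : nat) :
  0 <= alpha <= 1 -> 0 <= z <= 1 -> 0 <= basis_fun alpha s m j z.
Proof.
move=> /andP[a0 a1] /andP[z0 z1].
have a1' : 0 <= 1 - alpha by rewrite subr_ge0.
have z1' : 0 <= 1 - z by rewrite subr_ge0.
rewrite /basis_fun; case: ifP => _; first by rewrite !mulr_ge0 ?exprn_ge0.
by rewrite !addr_ge0 ?mulr_ge0 ?exprn_ge0//; case: ifP => _ //;
  rewrite !mulr_ge0 ?exprn_ge0.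
Qed.

(** * The operator as an average over [0, 1] *)

(** Here [w] is a probability density, so the constants [a] and [c] equal their own averages; the
    pointwise bound can then be multiplied by [w] and integrated. *)
Lemma weighted_Rintegral_dist (d : measure_display) (T : measurableType d)
    (R : realType) (mu : {measure set T -> \bar R}) (D : set T)
    (w f g : T -> R) (a b c : R) :
  measurable D -> (forall t, D t -> 0 <= w t) ->
  mu.-integrable D (EFin \o w) -> \int[mu]_(t in D) w t = 1 ->
  mu.-integrable D (EFin \o (fun t => w t * f t)) ->
  mu.-integrable D (EFin \o (fun t => w t * g t)) ->
  (forall t, D t -> `|f t - c| <= a + b * g t) ->
  `|\int[mu]_(t in D) (w t * f t) - c| <=
    a + b * \int[mu]_(t in D) (w t * g t).
Proof.
move=> mD w0 iw w1 iwf iwg fg.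
have icw (k : R) : mu.-integrable D (EFin \o (fun t => k * w t)).
  exact: (integrableZl mD k iw).
have ibwg : mu.-integrable D (EFin \o (fun t => b * (w t * g t))).
  exact: (integrableZl mD b iwg).
have -> : c = \int[mu]_(t in D) (c * w t) by rewrite RintegralZl// w1 mulr1.
have -> : a = \int[mu]_(t in D) (a * w t) by rewrite RintegralZl// w1 mulr1.
rewrite -RintegralB// -RintegralZl// -RintegralD//.
have ifc : mu.-integrable D (EFin \o (fun t => w t * f t - c * w t)).
  exact: (integrableB mD iwf (icw c)).
apply: (le_trans (le_normr_Rintegral mD ifc)).
apply: le_Rintegral => //.
- exact: integrable_norm.
- exact: (integrableD mD (icw a) ibwg).
- move=> t Dt; rewrite (mulrC c) -mulrBr normrM ger0_norm ?w0//.
  apply: (le_trans (ler_wpM2l (w0 _ Dt) (fg _ Dt))).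
  by rewrite le_eqVlt; apply/orP; left; apply/eqP; ring.
Qed.

Section fractional_operator.
Variables (R : realType) (m : nat) (eta gamma : R).
Hypotheses (eta0 : 0 < eta) (gamma0 : 0 < gamma).

Let node (j : nat) (t : R) : R := (j%:R + t `^ gamma) / (m.+1)%:R.

Let bounded01 (f : R -> R) :=
  exists K : R, forall x, x \in `[0, 1] -> `|f x| <= K.

Lemma node_itv (j : nat) (t : R) : (j < m.+1)%N -> t \in `[0, 1] ->
  node j t \in `[0, 1].
Proof.
move=> jm; rewrite !in_itv/= => /andP[t0 t1].
rewrite /node divr_ge0 ?addr_ge0 ?powR_ge0//= ler_pdivrMr// mul1r.
apply: (@le_trans _ _ (j%:R + 1)); last by rewrite natr1 ler_nat.
rewrite lerD2l; have := ge0_ler_powR (ltW gamma0) (x := t) (y := 1).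
by rewrite !nnegrE powR1; apply.
Qed.

Lemma integrable_onem_powR :
  lebesgue_measure.-integrable `[0, 1]
    (EFin \o (fun t : R => (1 - t) `^ (eta - 1))).
Proof.
apply/integrableP; split.
  apply/measurable_EFinP/measurable_funTS; exact: measurable_onem_powR.
under eq_integral do rewrite /= ger0_norm ?powR_ge0//.
by rewrite integral_onem_powR// ltry.
Qed.

Lemma integrable_onem_powR_node (f : R -> R) (j : nat) : (j < m.+1)%N ->
  measurable_fun [set` `[0 : R, 1]] f -> bounded01 f ->
  lebesgue_measure.-integrable `[0, 1]
    (EFin \o (fun t : R => (1 - t) `^ (eta - 1) * f (node j t))).
Proof.
move=> jm mf [K fK].
have mfn : measurable_fun [set` `[0 : R, 1]] (f \o node j).
  apply: (@measurable_comp _ _ _ _ _ _ [set` `[0 : R, 1]]) => //.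
    by move=> _ [t /= t01 <-]; exact: node_itv.
  apply: measurable_funTS; apply: measurable_funM => //.
  by apply: measurable_funD => //; exact: measurable_powR.
apply: (integrableMl _ integrable_onem_powR mfn) => //.
exists K; split; first exact: num_real.
move=> x Kx t /= t01; apply: le_trans (ltW Kx).
by apply: fK; exact: node_itv.
Qed.

(** The quotient Gamma(eta + 1) / Gamma(eta) = eta turns the weight into the probability density eta
    (1 - t)^(eta - 1). *)
Lemma frac_opE (alpha : R) (s : nat) (f : R -> R) (z : R) :
  measurable_fun [set` `[0 : R, 1]] f -> bounded01 f ->
  frac_op alpha s m eta gamma f z = \sum_(j < m.+1) basis_fun alpha s m j z *
    \int[lebesgue_measure]_(t in `[0, 1])
      (eta * (1 - t) `^ (eta - 1) * f (node j t)).
Proof.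
move=> mf bf; rewrite /frac_op GammaD1// mulr_sumr; apply: eq_bigr => j _.
rewrite mulrCA; congr (_ * _).
have ij := integrable_onem_powR_node (ltn_ord j) mf bf.
under eq_Rintegral do rewrite mulrAC mulrC.
rewrite RintegralZl//.
under [in RHS]eq_Rintegral do rewrite -mulrA.
rewrite RintegralZl// mulrA mulfK// gt_eqF//; exact: Gamma_gt0.
Qed.

(** Two averagings are combined: over t with a probability density, then over j with the nonnegative
    weights [basis_fun]. As these sum to 1, [a] and [c] can be distributed over the terms and each j
    treated separately. *)
Lemma frac_op_dist (alpha : R) (s : nat) (f g : R -> R) (a b c z : R) :
  0 <= alpha <= 1 -> 0 <= z <= 1 ->
  measurable_fun [set` `[0 : R, 1]] f -> bounded01 f ->
  measurable_fun [set` `[0 : R, 1]] g -> bounded01 g ->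
  (forall x, x \in `[0, 1] -> `|f x - c| <= a + b * g x) ->
  `|frac_op alpha s m eta gamma f z - c| <=
    a + b * frac_op alpha s m eta gamma g z.
Proof.
move=> halpha hz mf bf mg bg fg; rewrite !frac_opE//.
have sum_q (k : R) : k = \sum_(j < m.+1) basis_fun alpha s m j z * k.
  by rewrite -mulr_suml sum_basis_fun mul1r.
rewrite [c]sum_q [a]sum_q mulr_sumr -sumrB -big_split/=.
apply: (le_trans (ler_norm_sum _ _ _)); apply: ler_sum => j _.
have q0 := basis_fun_ge0 s m j halpha hz.
rewrite -mulrBr normrM (ger0_norm q0) mulrCA -mulrDr ler_wpM2l//.
have iw := integrable_onem_powR.
have ieta (h : R -> R) : measurable_fun [set` `[0 : R, 1]] h -> bounded01 h ->
    lebesgue_measure.-integrable `[0, 1]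
      (EFin \o (fun t : R => eta * (1 - t) `^ (eta - 1) * h (node j t))).
  move=> mh bh.
  apply: eq_integrable (integrableZl _ eta
    (integrable_onem_powR_node (ltn_ord j) mh bh)) => // t _.
  by rewrite /= -EFinM mulrA.
apply: weighted_Rintegral_dist => //.
- by move=> t _; rewrite mulr_ge0 ?powR_ge0// ltW.
- exact: (integrableZl _ eta iw).
- rewrite RintegralZl// /Rintegral integral_onem_powR//= divff//.
  by rewrite gt_eqF.
- exact: ieta.
- exact: ieta.
- by move=> t /= t01; apply: fg; exact: node_itv.
Qed.

Lemma frac_op_ge0 (alpha : R) (s : nat) (f : R -> R) (z : R) :
  0 <= alpha <= 1 -> 0 <= z <= 1 ->
  measurable_fun [set` `[0 : R, 1]] f -> bounded01 f ->
  (forall x, x \in `[0, 1] -> 0 <= f x) ->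
  0 <= frac_op alpha s m eta gamma f z.
Proof.
move=> ha hz mf bf f0; rewrite frac_opE//; apply: sumr_ge0 => j _.
rewrite mulr_ge0 ?basis_fun_ge0//; apply: Rintegral_ge0 => t /= t01.
by rewrite !mulr_ge0 ?powR_ge0 ?f0 ?node_itv// ltW.
Qed.

End fractional_operator.

(** * The tangent bound and the Lipschitz estimate *)

(** The right side is the tangent to x^p at c, evaluated at a. The bound is Young's inequality for
    (a/c)^p and 1 with exponents 1/p and 1/(1 - p), multiplied by c^p. *)
Lemma powR_tangent (R : realType) (p a c : R) : 0 < p < 1 -> 0 <= a -> 0 < c ->
  a `^ p <= (1 - p) * c `^ p + p * c `^ (p - 1) * a.
Proof.
move=> /andP[p0 p1] a0 c0.
have p1' : 0 < 1 - p by rewrite subr_gt0.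
have ac0 : 0 <= a / c by rewrite divr_ge0// ltW.
have := @conjugate_powR R ((a / c) `^ p) 1 p^-1 (1 - p)^-1 (powR_ge0 _ _) ler01.
rewrite !invrK !invr_gt0 => /(_ p0 p1' (subrKC _ _)).
rewrite mulr1 powR1 mul1r -powRrM mulfV ?gt_eqF// powRr1// => young.
have -> : a `^ p = (a / c) `^ p * c `^ p.
  by rewrite -powRM ?divfK ?gt_eqF// ltW.
apply: (le_trans (ler_wpM2r (powR_ge0 _ _) young)).
rewrite -(mulr_powRB1 (ltW c0) p0) le_eqVlt; apply/orP; left; apply/eqP.
by field; rewrite gt_eqF.
Qed.

Theorem theorem4 (R : realType) (m s : nat) (eta gamma alpha z M kappa : R)
    (phi : R -> R)
    (hm : (0 < m)%N) (heta : 0 < eta) (hgamma : 0 < gamma)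
    (halpha : 0 <= alpha <= 1) (hz : 0 <= z <= 1)
    (hM : 0 < M) (hkappa : 0 < kappa <= 1)
    (hphi : {within `[0, 1], continuous phi})
    (hLip : Lip M kappa phi) :
  `|frac_op alpha s m eta gamma phi z - phi z|
    <= M * second_central_moment alpha s m eta gamma z `^ (kappa / 2).
Proof.
have /andP[k0 k1] := hkappa.
set p := kappa / 2.
have p0 : 0 < p by rewrite divr_gt0.
have p1 : p < 1 by rewrite /p; lra.
have mphi : measurable_fun [set` `[0 : R, 1]] phi.
  exact: subspace_continuous_measurable_fun.
have bphi : exists K : R, forall x, x \in `[0, 1] -> `|phi x| <= K.
  (* Compare with the value at 0: the Lipschitz bound gives M x^kappa <= M on [0, 1]. *)
  exists (`|phi 0| + M) => x x01; rewrite -[phi x](subrKC (phi 0)).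
  apply: (le_trans (ler_normD _ _)); rewrite lerD2l.
  apply: (le_trans (hLip _ _ x01 _)); first by rewrite in_itv/= lexx ler01.
  rewrite ler_piMr ?(ltW hM)// subr0.
  move: x01; rewrite in_itv/= => /andP[x0 x1]; rewrite ger0_norm//.
  have := ge0_ler_powR (ltW k0) (x := x) (y := 1).
  by rewrite !nnegrE powR1; apply.
pose g (t : R) := (t - z) ^+ 2.
have mg : measurable_fun [set` `[0 : R, 1]] g.
  apply: measurable_funTS; apply: measurable_funX.
  by apply: measurable_funB => //; exact: measurable_cst.
have bg : exists K : R, forall x, x \in `[0, 1] -> `|g x| <= K.
  exists 1 => x; rewrite in_itv/= => /andP[x0 x1]; rewrite /g.
  have /andP[z0 z1] := hz.
  by rewrite ger0_norm ?sqr_ge0//; nra.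
rewrite /second_central_moment -/g; set A := frac_op _ _ _ _ _ g z.
set L : R := `|_|.
have A0 : 0 <= A by apply: frac_op_ge0 => // x _; exact: sqr_ge0.
(* Since |x - z|^kappa = ((x - z)^2)^p, the Lipschitz bound followed by the tangent at c is affine
   in [g x], the form that [frac_op_dist] accepts. *)
have LA (c : R) : 0 < c -> L <= M * ((1 - p) * c `^ p) + M * (p * c `^ (p - 1)) * A.
  move=> c0; apply: frac_op_dist => // x x01.
  apply: (le_trans (hLip _ _ x01 _)); first by rewrite in_itv.
  rewrite -mulrA -mulrDr ler_pM2l//.
  apply: le_trans (powR_tangent _ _ c0); rewrite ?sqr_ge0 ?p0//.
  rewrite /g -(real_normK (num_real _)) -powR_mulrn// -powRrM /p.
  by rewrite mulrC divfK.
(* The tangent exists only at c > 0. For A > 0, taking c = A merges the two terms: (1 - p) A^p + p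
   A^(p-1) A = A^p. *)
have [A_gt0|] := ltP 0 A.
  apply: (le_trans (LA _ A_gt0)); rewrite -mulrA -mulrDr ler_pM2l//.
  by rewrite -mulrA (mulrC _ A) mulr_powRB1//; lra.
move=> A_le0; have {A_le0 A0}A0 : A = 0 by apply/eqP; rewrite eq_le A_le0.
rewrite A0 powR0 ?mulr0 ?gt_eqF//.
(* For a zero moment the tangent bound at c reads L <= M (1 - p) c^p; the choice
   c^p = L / M refutes L > 0. *)
rewrite leNgt; apply/negP => L0.
have LM : 0 < L / M by rewrite divr_gt0.
have := LA ((L / M) `^ p^-1); rewrite powR_gt0// => /(_ isT).
rewrite A0 mulr0 addr0 -powRrM mulVf ?gt_eqF// powRr1; last exact: ltW.
rewrite mulrCA (mulrC M) divfK ?gt_eqF// leNgt => /negP; apply.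
by rewrite mulrBl mul1r ltrBlDr ltrDl mulr_gt0.
Qed.
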